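(* Let $T>0$ be a fixed expiry and let $C(K)=e^{-rT}\mathbb E^*[(X_T-K)^+]$ be the call pricing function. (a) In the (uncorrelated) Stein-Stein model, as $K\to\infty$, $$C(K)=e^{-rT}\frac{B_0}{(1-B_3)(2-B_3)}(\log K)^{-\frac12}e^{B_2\sqrt{\log K}}K^{2-B_3}\left(1+O\left((\log K)^{-\frac14}\right)\right).$$ (b) In the (uncorrelated) Heston model, as $K\to\infty$, $$C(K)=e^{-rT}\frac{A_0}{(1-A_3)(2-A_3)}(\log K)^{-\frac34+\frac{qm}{c^2}}e^{A_2\sqrt{\log K}}K^{2-A_3}\left(1+O\left((\log K)^{-\frac14}\right)\right).$$ Here $B_0,B_2,B_3$ and $A_0,A_2,A_3$ are the constants in the asymptotic formulas for the density of $X_T$ given in the context.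
   Context: In both models $W^*,Z^*$ are independent Brownian motions under $\mathbb P^*$, $X_0=x_0>0$, $Y_0=y_0$, $r\ge0$. Stein-Stein: $dX_t=rX_tdt+|Y_t|X_tdW_t^*$, $dY_t=q(m-Y_t)dt+\sigma dZ_t^*$, with $q,m\ge0$, $\sigma>0$. Heston: $dX_t=rX_tdt+\sqrt{Y_t}X_tdW_t^*$, $dY_t=q(m-Y_t)dt+c\sqrt{Y_t}dZ_t^*$, with $q,m\ge0$, $c>0$. Let $D_T$ be the density of $X_T$. The following is known (previously established results that may be taken as given), with constants depending on $T$ and the model parameters, as $x\to\infty$. Stein-Stein: there are $B_1>0,B_2>0,B_3>2$ with $D_T(x_0e^{rT}x)=B_1(\log x)^{-1/2}e^{B_2\sqrt{\log x}}x^{-B_3}(1+O((\log x)^{-1/4}))$; put $B_0=B_1(x_0e^{rT})^{B_3}$. Then $D_T(x)=B_0(\log x)^{-1/2}e^{B_2\sqrt{\log x}}x^{-B_3}(1+O((\log x)^{-1/4}))$. Heston: there are $A_1>0,A_2>0,A_3>2$ with $D_T(x_0e^{rT}x)=A_1(\log x)^{-\frac34+\frac{qm}{c^2}}e^{A_2\sqrt{\log x}}x^{-A_3}(1+O((\log x)^{-1/4}))$; put $A_0=A_1(x_0e^{rT})^{A_3}$. Then $D_T(x)=A_0(\log x)^{-\frac34+\frac{qm}{c^2}}e^{A_2\sqrt{\log x}}x^{-A_3}(1+O((\log x)^{-1/4}))$. *)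

(* Defs.v *)
From HB Require Import structures.
From mathcomp Require Export all_boot all_order all_algebra.
From mathcomp Require Export all_classical all_reals all_analysis.
Export Order.TTheory GRing.Theory Num.Theory.
Export numFieldNormedType.Exports.

Set Implicit Arguments.
Unset Strict Implicit.
Unset Printing Implicit Defensive.

Global Open Scope classical_set_scope.
Global Open Scope ring_scope.

Section processes.
Context {R : realType} {d : measure_display} {Omega : measurableType d}.
Variable P : probability Omega R.

(* Processes are maps [R -> Omega -> R]; only times [0 <= t] are meaningful,
   and no condition below looks at negative times. *)
Implicit Types (F : R -> set (set Omega)) (X Y W Z H I : R -> Omega -> R).

Definition filtration F : Prop :=
  [/\ forall t, 0 <= t -> sigma_algebra setT (F t),
      forall t, 0 <= t -> F t `<=` measurable &
      forall s t, 0 <= s -> s <= t -> F s `<=` F t].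

Definition measurable_wrt (G : set (set Omega)) (f : Omega -> R) : Prop :=
  forall B : set R, measurable B -> G (f @^-1` B).

Definition adapted F X : Prop :=
  forall t, 0 <= t -> measurable_wrt (F t) (X t).

Definition continuous_paths X : Prop :=
  forall w, {within `[0, +oo[, continuous (fun t : R => X t w)}.

Definition independent_families (G1 G2 : set (set Omega)) : Prop :=
  forall A B, G1 A -> G2 B -> P (A `&` B) = (P A * P B)%E.

Definition process_sigma_algebra X : set (set Omega) :=
  <<s [set A | exists t (B : set R),
         [/\ 0 <= t, measurable B & A = X t @^-1` B]] >>.

Definition independent_processes X Y : Prop :=
  independent_families (process_sigma_algebra X) (process_sigma_algebra Y).

(* The second parameter of [normal_prob] is the standard deviation. *)
Definition brownian_motion F W : Prop :=
  [/\ adapted F W, continuous_paths W, forall w, W 0 w = 0 &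
      forall s t, 0 <= s -> s < t ->
        (forall B : set R, measurable B ->
           P ((fun w => W t w - W s w) @^-1` B) =
             normal_prob 0 (Num.sqrt (t - s)) B) /\
        independent_families (F s)
          [set A | exists2 B : set R, measurable B &
                     A = (fun w => W t w - W s w) @^-1` B]].

Definition cvg_in_probability (f : nat -> Omega -> R) (g : Omega -> R) : Prop :=
  forall e : R, 0 < e ->
    (fun n => P [set w | e <= `|f n w - g w|]) @ \oo --> 0%E.

(* The process [\sum_(i < sp_size) sp_coef i * 1_(] sp_time i, sp_time i.+1 ]) *)
Record simple_process := SimpleProcess {
  sp_size : nat;
  sp_time : nat -> R;
  sp_coef : nat -> Omega -> R }.

Definition sp_predictable F (S : simple_process) : Prop :=
  forall i, (i < sp_size S)%N ->
    [/\ 0 <= sp_time S i, sp_time S i <= sp_time S i.+1,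
        measurable_wrt (F (sp_time S i)) (sp_coef S i) &
        exists M : R, forall w, `|sp_coef S i w| <= M].

Definition sp_eval (S : simple_process) (t : R) (w : Omega) : R :=
  \sum_(i < sp_size S)
    sp_coef S i w * (\1_(`]sp_time S i, sp_time S i.+1]%classic) t).

Definition sp_integral (S : simple_process) W (t : R) (w : Omega) : R :=
  \sum_(i < sp_size S) sp_coef S i w *
    (W (Num.min (sp_time S i.+1) t) w - W (Num.min (sp_time S i) t) w).

(* [I t] is a version of [\int_0^t H dW]: the limit in probability of the
   integrals of simple processes [S n] with [\int_0^t (S n - H)^2 ds -> 0] in
   probability.  The limit does not depend on the approximating sequence; one
   exists for every continuous adapted [H]. *)
Definition ito_integral F W H I : Prop :=
  exists S : nat -> simple_process,
    (forall n, sp_predictable F (S n)) /\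
    forall t, 0 <= t ->
      cvg_in_probability
        (fun n w => Rintegral lebesgue_measure `[0, t]%classic
                      (fun s : R => (sp_eval (S n) s w - H s w) ^+ 2))
        (fun=> 0) /\
      measurable_fun setT (I t) /\
      cvg_in_probability (fun n w => sp_integral (S n) W t w) (I t).

(* [dX = drift dt + diffusion dW] with [X_0 = x0], in integral form. *)
Definition solves_sde F W X (x0 : R) (drift diffusion : R -> Omega -> R)
    : Prop :=
  [/\ adapted F X, continuous_paths X &
      exists2 I, ito_integral F W diffusion I &
        forall t, 0 <= t ->
          {ae P, forall w, X t w =
             x0 + Rintegral lebesgue_measure `[0, t]%classic
                    (fun s : R => drift s w) + I t w}].

Definition independent_brownian_motions F W Z : Prop :=
  [/\ filtration F, brownian_motion F W, brownian_motion F Z &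
      independent_processes W Z].

Definition stein_stein_model (r q m sigma x0 y0 : R) F W Z X Y : Prop :=
  [/\ independent_brownian_motions F W Z,
      solves_sde F W X x0 (fun t w => r * X t w)
                          (fun t w => `|Y t w| * X t w) &
      solves_sde F Z Y y0 (fun t w => q * (m - Y t w)) (fun _ _ => sigma)].

(* [Num.sqrt] is [0] on negative arguments; the third clause makes the square
   roots genuine. *)
Definition heston_model (r q m c x0 y0 : R) F W Z X Y : Prop :=
  [/\ independent_brownian_motions F W Z,
      solves_sde F W X x0 (fun t w => r * X t w)
                          (fun t w => Num.sqrt (Y t w) * X t w),
      forall t, 0 <= t -> {ae P, forall w, 0 <= Y t w} &
      solves_sde F Z Y y0 (fun t w => q * (m - Y t w))
                          (fun t w => c * Num.sqrt (Y t w))].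

Definition is_density (D : R -> R) (f : Omega -> R) : Prop :=
  [/\ measurable_fun setT D, forall x, 0 <= D x &
      forall B : set R, measurable B ->
        P (f @^-1` B) = (\int[lebesgue_measure]_(x in B) (D x)%:E)%E].

Definition call_price (r T : R) X (K : R) : \bar R :=
  ((expR (- r * T))%:E * 'E_P[(fun w => Num.max (X T w - K) 0)%R])%E.

End processes.

(* The Landau notations expect a bundled filter. *)
Definition pinfty_filter (R : realType) : filter_on R :=
  FilterType (pinfty_nbhs R) (filter_filter (F := pinfty_nbhs R)).

(* [f x = g x * (1 + O(h x))] as [x -> +oo]; in particular [f x] is finite for
   all large [x]. *)
Definition asymptotic {R : realType} (f : R -> \bar R) (g h : R -> R) : Prop :=
  exists2 e : R -> R^o, e =O_ (pinfty_filter R) (h : R -> R^o) &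
    \forall x \near +oo_R, f x = (g x * (1 + e x))%:E.

(* Main.v *)
Require Import Defs.
From mathcomp Require Import measurable_realfun ring lra.

(** Put [G x = (ln x)^p e^(b sqrt (ln x)) x^(2 - c)].  Both [G'] and [G''] are
    combinations of functions of the same shape, and [G'' x] is
    [(1 - c)(2 - c) (ln x)^p e^(b sqrt (ln x)) x^(-c) (1 + O((ln x)^(-1/2)))].
    Hence the density is a constant [C] times [G'' x (1 + O((ln x)^(-1/4)))], and
    since [(ln x)^(-1/4)] decreases, on the ray [x >= K] it lies between
    [C (1 -+ M (ln K)^(-1/4)) G''].  Integrating twice, first the density to the
    tail probability and then the tail probability to [E (X - K)^+], traps the
    expectation between [C (1 -+ M (ln K)^(-1/4)) G K]; no integral has to be
    expanded asymptotically. *)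

(** * Integrals over rays and bounds for the expected payoff *)

Lemma ge0_integral_derivative_ray (R : realType) (G g : R -> R) (K : R) :
  (forall x, K <= x -> 0 <= g x) ->
  (forall x, K <= x -> {for x, continuous g}) ->
  (forall x, K <= x -> is_derive x 1 G (- g x)) ->
  G x @[x --> +oo] --> 0 ->
  (\int[lebesgue_measure]_(x in `[K, +oo[) (g x)%:E = (G K)%:E)%E.
Proof.
move=> g0 cg dG G0.
have dN x : K <= x -> is_derive x 1 (- G) (g x).
  by move=> Kx; rewrite -[g x]opprK; apply: is_deriveN; exact: dG.
rewrite (@ge0_continuous_FTC2y _ g (- G) K 0) //.
- by rewrite sub0e EFinN oppeK.
- apply/continuous_within_itvcyP; split.
    by move=> x; rewrite in_itv/= andbT => /ltW /cg.
  by apply: cvg_at_right_filter; exact: cg.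
- by rewrite -oppr0; exact: cvgN.
- by move=> x Kx; apply: (@ex_derive _ _ _ _ _ _ _ (dN _ (ltW Kx))).
- apply: cvg_at_right_filter.
  apply: differentiable_continuous; apply/derivable1_diffP.
  exact: (@ex_derive _ _ _ _ _ _ _ (dN _ (lexx _))).
- move=> x; rewrite in_itv/= andbT => Kx; rewrite derive1E.
  exact: (@derive_val _ _ _ _ _ _ _ (dN _ (ltW Kx))).
Qed.

Section call_sandwich.
Context {R : realType} {d : measure_display} {Omega : measurableType d}.
Context {P : probability Omega R} {D : R -> R} {S : Omega -> R}.
Hypotheses (mS : measurable_fun setT S) (hD : is_density P D S).
Variables (G G1 G2 : R -> R) (K lo hi : R).
Hypotheses (lo0 : 0 <= lo) (hi0 : 0 <= hi).
Hypotheses (dG : forall x, K <= x -> is_derive x 1 G (G1 x)).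
Hypotheses (dG1 : forall x, K <= x -> is_derive x 1 G1 (G2 x)).
Hypotheses (cG2 : forall x, K <= x -> {for x, continuous G2}).
Hypotheses (G1_le0 : forall x, K <= x -> G1 x <= 0).
Hypotheses (G2_ge0 : forall x, K <= x -> 0 <= G2 x).
Hypotheses (G_cvg0 : G x @[x --> +oo] --> 0) (G1_cvg0 : G1 x @[x --> +oo] --> 0).
Hypotheses (loD : forall x, K <= x -> lo * G2 x <= D x).
Hypotheses (hiD : forall x, K <= x -> D x <= hi * G2 x).

Lemma measurable_ray_of_continuous (g : R -> R) (a : R) :
  (forall x, a <= x -> {for x, continuous g}) -> measurable_fun `[a, +oo[ g.
Proof.
move=> cg; apply: subspace_continuous_measurable_fun => //.
apply: continuous_in_subspaceT => x; rewrite inE/= in_itv/= andbT.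
exact: cg.
Qed.

(** The first integration: [- G1] is a primitive of [- G2] that vanishes at infinity, so [G2]
    integrates to [- G1 t] over the ray, and the bounds on [D] integrate termwise. *)
Lemma tail_sandwich (t : R) : K <= t ->
  ((lo * - G1 t)%:E <= P (S @^-1` `]t, +oo[) <= (hi * - G1 t)%:E)%E.
Proof.
move=> Kt; have [mD D0 PD] := hD.
(* The open ray is what the complementary distribution function produces; its endpoint is
   Lebesgue-null. *)
have -> : P (S @^-1` `]t, +oo[) =
    (\int[lebesgue_measure]_(x in `[t, +oo[) (D x)%:E)%E.
  rewrite PD// integral_itv_obnd_cbnd//.
  by apply/measurable_EFinP; apply: measurable_funTS.
have mG2 : measurable_fun `[t, +oo[ (fun x => (G2 x)%:E).
  apply/measurable_EFinP; apply: measurable_ray_of_continuous => x tx.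
  by apply: cG2; exact: le_trans tx.
have mcG2 (c : R) : measurable_fun `[t, +oo[ (fun x => (c * G2 x)%:E).
  apply/measurable_EFinP; apply: measurable_funM => //.
  exact/measurable_EFinP.
have IG2 (c : R) : 0 <= c -> ((c * - G1 t)%:E =
    \int[lebesgue_measure]_(x in `[t, +oo[) (c * G2 x)%:E)%E.
  move=> c0; under eq_integral do rewrite EFinM.
  rewrite ge0_integralZl//=; last first.
    by move=> x; rewrite in_itv/= andbT lee_fin => tx; apply/G2_ge0/(le_trans Kt).
  rewrite EFinM; congr (_ * _)%E; apply/esym.
  apply: (@ge0_integral_derivative_ray _ (- G1)).
  - by move=> x tx; apply/G2_ge0/(le_trans Kt).
  - by move=> x tx; apply/cG2/(le_trans Kt).
  - by move=> x tx; apply: is_deriveN; apply/dG1/(le_trans Kt).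
  - by rewrite -oppr0; exact: cvgN.
rewrite !IG2//; apply/andP; split; apply: ge0_le_integral => //=.
- by move=> x; rewrite in_itv/= andbT lee_fin => /(le_trans Kt) Kx; rewrite mulr_ge0// G2_ge0.
- exact: mcG2.
- by apply/measurable_EFinP; apply: measurable_funTS.
- by move=> x; rewrite in_itv/= andbT lee_fin => /(le_trans Kt) Kx; exact: loD.
- by move=> x; rewrite lee_fin.
- by apply/measurable_EFinP; apply: measurable_funTS.
- exact: mcG2.
- by move=> x; rewrite in_itv/= andbT lee_fin => /(le_trans Kt) Kx; exact: hiD.
Qed.

(** The second integration: the expectation of a nonnegative variable is the integral of its tail,
    here [P (S > K + s)] over [s >= 0], and [- G1 (K + s)] integrates to [G K]. The upper bound also
    shows that the expectation is finite. *)
Lemma expectation_call_sandwich :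
  ((lo * G K)%:E <= 'E_P[(fun w => Num.max (S w - K) 0)%R] <= (hi * G K)%:E)%E.
Proof.
have mV : measurable_fun setT (fun w => Num.max (S w - K) 0).
  apply: measurable_maxr => //; exact: measurable_funB.
pose V : {RV P >-> R} := mfun_Sub (mem_set mV).
have -> : ('E_P[(fun w => Num.max (S w - K) 0)%R] = 'E_P[V])%E by [].
rewrite ge0_expectation_ccdf; last by move=> w; rewrite /= le_max lexx orbT.
(* For [s >= 0] the maximum with [0] exceeds [s] only through its first argument. *)
have ccdfE (s : R) : 0 <= s -> ccdf V s = P (S @^-1` `]K + s, +oo[).
  move=> s0; rewrite /ccdf /distribution /pushforward; congr (P _).
  apply/seteqP; split => w /=; rewrite !in_itv/= !andbT lt_max;
    rewrite ltrBrDl; last by move=> ->.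
  by move=> /orP[//|]; rewrite ltNge s0.
have mccdf : measurable_fun (`[0, +oo[%classic : set R) (ccdf V).
  by apply: measurable_funTS; exact: ccdf_measurable.
have cG1 x : K <= x -> {for x, continuous G1}.
  move=> Kx; apply: differentiable_continuous; apply/derivable1_diffP.
  exact: (@ex_derive _ _ _ _ _ _ _ (dG1 _ Kx)).
have Ks (s : R) : 0 <= s -> K <= K + s by rewrite lerDl.
have cs (s : R) : 0 <= s -> {for s, continuous (fun s : R => - G1 (K + s))}.
  move=> s0; apply: cvgN; apply: (@cvg_comp _ _ _ (fun s => K + s) G1).
    by apply: cvgD; [exact: cvg_cst|exact: cvg_id].
  by apply: cG1; exact: Ks.
have mG1 : measurable_fun (`[0, +oo[%classic : set R) (fun s => (- G1 (K + s))%:E).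
  by apply/measurable_EFinP; apply: measurable_ray_of_continuous => x /cs.
have mcG1 (c : R) : measurable_fun (`[0, +oo[%classic : set R) (fun s => (c * - G1 (K + s))%:E).
  apply/measurable_EFinP; apply: measurable_funM => //.
  exact/measurable_EFinP.
have IG1 (c : R) : 0 <= c -> ((c * G K)%:E =
    \int[lebesgue_measure]_(x in `[0%R, +oo[) (c * - G1 (K + x))%:E)%E.
  move=> c0; under eq_integral do rewrite EFinM.
  rewrite ge0_integralZl//=; last first.
    by move=> x; rewrite in_itv/= andbT lee_fin oppr_ge0 => /Ks/G1_le0.
  rewrite EFinM -[in G K](addr0 K); congr (_ * _)%E; apply/esym.
  apply: (@ge0_integral_derivative_ray _ (fun s => G (K + s))).
  - by move=> x /Ks/G1_le0; rewrite oppr_ge0.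
  - exact: cs.
  - move=> x x0; rewrite opprK -[G1 _]mulr1.
    have dK : is_derive x (1:R) (fun s : R => K + s) 1.
      by have := is_deriveD (is_derive_cst K x 1) (is_derive_id x (1:R)); rewrite add0r.
    have dGx := dG _ (Ks _ x0).
    exact: (@is_derive1_comp _ G (fun s : R => K + s) x _ _ dGx dK).
  - apply: (@cvg_comp _ _ _ (fun s => K + s) G _ +oo) => //.
    exact: cvg_addrl.
rewrite !IG1//; apply/andP; split; apply: ge0_le_integral => //=.
- move=> x; rewrite in_itv/= andbT lee_fin => /Ks Kx.
  by rewrite mulr_ge0// oppr_ge0 G1_le0.
- exact: mcG1.
- move=> x; rewrite in_itv/= andbT => x0; rewrite ccdfE//.
  by have /andP[] := tail_sandwich _ (Ks _ x0).
- exact: mcG1.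
- move=> x; rewrite in_itv/= andbT => x0; rewrite ccdfE//.
  by have /andP[] := tail_sandwich _ (Ks _ x0).
Qed.

End call_sandwich.

(** * Calculus of the functions [(ln x)^p e^(b sqrt (ln x)) x^g] *)

Section log_exp_power.
Context {R : realType}.
Implicit Types (p b g x u e : R).

Definition log_exp_power p b g x : R :=
  ln x `^ p * expR (b * Num.sqrt (ln x)) * x `^ g.

(** Integration from [K] onwards needs the eventual bounds on the whole ray, not only at [K]. *)
Lemma near_pinfty_forall_ge (Q : R -> Prop) :
  (\forall x \near +oo, Q x) -> \forall K \near +oo, forall x : R, K <= x -> Q x.
Proof.
move=> [M [Mr HM]]; exists M; split => // K MK x Kx.
exact/HM/(lt_le_trans MK).
Qed.

Lemma near_ln_ge (M : R) : \forall x \near +oo, M <= ln x.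
Proof.
near=> x.
have Mx : expR M <= x by near: x; apply: nbhs_pinfty_ge; rewrite num_real.
by rewrite -[M]expRK ler_ln ?posrE ?expR_gt0// (lt_le_trans _ Mx) ?expR_gt0.
Unshelve. all: by end_near. Qed.

Lemma near_sqrt_ln_ge (M : R) : \forall x \near +oo, M <= Num.sqrt (ln x).
Proof.
near=> x.
have Mx : M ^+ 2 <= ln x by near: x; exact: near_ln_ge.
by rewrite (le_trans (ler_norm M))// -sqrtr_sqr ler_wsqrtr.
Unshelve. all: by end_near. Qed.

Lemma log_exp_power_gt0 p b g x : 1 < x -> 0 < log_exp_power p b g x.
Proof.
move=> x1; rewrite /log_exp_power !mulr_gt0 ?powR_gt0 ?expR_gt0 ?ln_gt0//.
exact: lt_trans x1.
Qed.

(** Differentiation lowers the exponent of [ln x] in steps of one half; this turns such a step into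
    a factor [(sqrt (ln x))^-1], so that derivatives become polynomials in that quantity. *)
Lemma powR_subn_half u p n : 0 < u ->
  u `^ (p - n%:R / 2) = u `^ p * (Num.sqrt u)^-1 ^+ n.
Proof.
move=> u0; rewrite powRB ?(gt_eqF u0) ?implybT//; congr (_ * _).
by rewrite mulrC powRrM powR12_sqrt ?(ltW u0)// powR_mulrn ?sqrtr_ge0// exprVn.
Qed.

Lemma log_exp_power_subn_half p b g x n : 1 < x ->
  log_exp_power (p - n%:R / 2) b g x =
  log_exp_power p b g x * (Num.sqrt (ln x))^-1 ^+ n.
Proof.
move=> x1; rewrite /log_exp_power powR_subn_half ?ln_gt0//.
ring.
Qed.

(** The exponent [p - 1] is spelled [p - 2 / 2] to match
    [log_exp_power_subn_half]. *)
Lemma is_derive_log_exp_power p b g x : 1 < x ->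
  is_derive x 1 (log_exp_power p b g)
    (p * log_exp_power (p - 2 / 2) b (g - 1) x
     + b / 2 * log_exp_power (p - 1 / 2) b (g - 1) x
     + g * log_exp_power p b (g - 1) x).
Proof.
move=> x1.
have x0 : 0 < x by exact: lt_trans x1.
have u0 : 0 < ln x by rewrite ln_gt0.
have dln := is_derive1_ln x0.
have d1 : is_derive x 1 (fun x : R => ln x `^ p) (p * ln x `^ (p - 1) * x^-1).
  exact: (@is_derive1_comp _ (fun y : R => y `^ p) (@ln R) x _ _ (is_derive1_powR p u0) dln).
have ds : is_derive x 1 (fun x : R => Num.sqrt (ln x)) ((2 * Num.sqrt (ln x))^-1 * x^-1).
  exact: (@is_derive1_comp _ (@Num.sqrt R) (@ln R) x _ _ (is_derive1_sqrt u0) dln).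
have d2 : is_derive x 1 (fun x : R => expR (b * Num.sqrt (ln x)))
    (expR (b * Num.sqrt (ln x)) * (b * ((2 * Num.sqrt (ln x))^-1 * x^-1))).
  exact: (@is_derive1_comp _ (@expR R) (fun x : R => b * Num.sqrt (ln x)) x _ _
           (is_derive_expR _) (is_deriveZ b ds)).
have d3 := is_derive1_powR g x0.
have d12 := is_deriveM d1 d2.
have d := is_deriveM d12 d3.
apply: (is_derive_eq d).
rewrite (log_exp_power_subn_half _ _ _ _ 2)// (log_exp_power_subn_half _ _ _ _ 1)//.
rewrite mulrfctE /log_exp_power /GRing.scale/=.
have -> : ln x `^ (p - 1) = ln x `^ p * (Num.sqrt (ln x))^-1 ^+ 2.
  by rewrite -powR_subn_half// divff.
have -> : x `^ (g - 1) = x `^ g * x^-1.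
  by rewrite powRB ?(gt_eqF x0) ?implybT// powRr1// ltW.
have s0 : 0 < Num.sqrt (ln x) by rewrite sqrtr_gt0.
set t := Num.sqrt _ in s0 *; set E := expR _; set A := _ `^ p; set B := _ `^ g.
by field; rewrite !gt_eqF.
Qed.

(** With [t = sqrt (ln x)] the logarithm of the function is [2 p ln t + b t + g t^2], and the
    negative quadratic term wins. *)
Lemma log_exp_power_cvg0 p b g : g < 0 ->
  log_exp_power p b g x @[x --> +oo] --> 0.
Proof.
move=> g0; apply/cvgr0Pnorm_le => e e0; near=> x.
have x1 : 1 < x by near: x; apply: nbhs_pinfty_gt; rewrite num_real.
have t1 : 1 <= Num.sqrt (ln x) by near: x; exact: near_sqrt_ln_ge.
have te : e^-1 <= Num.sqrt (ln x) by near: x; exact: near_sqrt_ln_ge.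
(* Beyond this threshold [g t^2] absorbs the other two terms, using [ln t <= t], and leaves [- t];
   then [e^(-t) <= 1 / t <= e]. *)
have tM : (2 * `|p| + `|b| + 1) / - g <= Num.sqrt (ln x).
  by near: x; exact: near_sqrt_ln_ge.
rewrite gtr0_norm ?log_exp_power_gt0//.
have x0 : 0 < x by exact: lt_trans x1.
have u0 : 0 < ln x by rewrite ln_gt0.
rewrite /log_exp_power /powR !gt_eqF// -!expRD.
have lnE : ln x = Num.sqrt (ln x) ^+ 2 by rewrite sqr_sqrtr// ltW.
rewrite [in g * _]lnE [in ln (ln x)]lnE.
move: t1 te tM; set t := Num.sqrt (ln x) => t1 te tM.
have t0 : 0 < t by exact: lt_le_trans t1.
rewrite lnXn// mulr2n.
have lnt : ln t <= t by rewrite ltW// ln_sublinear.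
have lnt0 : 0 <= ln t by exact: ln_ge0.
suff E : p * (ln t + ln t) + b * t + g * t ^+ 2 <= - t.
  apply: (@le_trans _ _ (expR (- t))); first by rewrite ler_expR.
  rewrite expRN -[e]invrK.
  rewrite lef_pV2 ?posrE ?expR_gt0 ?invr_gt0// (le_trans te)//.
  by apply: le_trans (expR_ge1Dx t); rewrite lerDr.
rewrite ler_pdivrMr ?oppr_gt0// in tM.
have h1 : p * (ln t + ln t) <= 2 * `|p| * t.
  have := ler_norm p; have := normr_ge0 p; nra.
have h2 : b * t <= `|b| * t by rewrite ler_pM2r// ler_norm.
nra.
Unshelve. all: by end_near. Qed.

Definition log_exp_power1 p b g x : R :=
  p * log_exp_power (p - 2 / 2) b (g - 1) x
  + b / 2 * log_exp_power (p - 1 / 2) b (g - 1) x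
  + g * log_exp_power p b (g - 1) x.

(** The first derivative is a combination of functions of the same family with exponent [g - 1];
    here each of them is replaced by its own derivative. *)
Definition log_exp_power2 p b g x : R :=
  p * log_exp_power1 (p - 2 / 2) b (g - 1) x
  + b / 2 * log_exp_power1 (p - 1 / 2) b (g - 1) x
  + g * log_exp_power1 p b (g - 1) x.

Lemma is_derive_log_exp_power1 p b g x : 1 < x ->
  is_derive x 1 (log_exp_power1 p b g) (log_exp_power2 p b g x).
Proof.
move=> x1; rewrite /log_exp_power1.
have d q := is_derive_log_exp_power q b (g - 1) _ x1.
exact: is_deriveD (is_deriveD (is_deriveZ _ (d _)) (is_deriveZ _ (d _)))
  (is_deriveZ _ (d _)).
Qed.

Lemma continuous_log_exp_power2 p b g x : 1 < x ->
  {for x, continuous (log_exp_power2 p b g)}.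
Proof.
move=> x1.
have c q k : {for x, continuous (fun x => k * log_exp_power1 q b (g - 1) x)}.
  apply: cvgM; first exact: cvg_cst.
  have d := is_derive_log_exp_power1 q b (g - 1) _ x1.
  apply: differentiable_continuous; apply/derivable1_diffP.
  exact: (@ex_derive _ _ _ _ _ _ _ d).
exact: cvgD (cvgD (c _ _) (c _ _)) (c _ _).
Qed.

Lemma log_exp_power1_cvg0 p b g : g < 0 ->
  log_exp_power1 p b g x @[x --> +oo] --> 0.
Proof.
move=> g0.
have g1 : g - 1 < 0 by lra.
have c q k : k * log_exp_power q b (g - 1) x @[x --> +oo] --> 0.
  by rewrite -(mulr0 k); apply: cvgM; [exact: cvg_cst|exact: log_exp_power_cvg0].
by rewrite -(addr0 0) -(addr0 (0 + 0)); apply: cvgD (cvgD _ _) _; exact: c.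
Qed.

Lemma log_exp_power1E p b g x : 1 < x ->
  log_exp_power1 p b g x = log_exp_power p b (g - 1) x *
    (g + b / 2 * (Num.sqrt (ln x))^-1 + p * (Num.sqrt (ln x))^-1 ^+ 2).
Proof.
move=> x1; rewrite /log_exp_power1.
rewrite (log_exp_power_subn_half _ _ _ _ 2)// (log_exp_power_subn_half _ _ _ _ 1)//.
ring.
Qed.

(** The sign is that of [g + O(1 / sqrt (ln x))], whose limit is negative. It makes the tail bounds
    nonnegative. *)
Lemma near_log_exp_power1_le0 p b g : g < 0 ->
  \forall x \near +oo, log_exp_power1 p b g x <= 0.
Proof.
move=> g0; near=> x.
have x1 : 1 < x by near: x; apply: nbhs_pinfty_gt; rewrite num_real.
have t1 : 1 <= Num.sqrt (ln x) by near: x; exact: near_sqrt_ln_ge.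
have tM : (`|b| / 2 + `|p|) / - g <= Num.sqrt (ln x).
  by near: x; exact: near_sqrt_ln_ge.
rewrite log_exp_power1E// pmulr_rle0 ?log_exp_power_gt0//.
move: t1 tM; set t := Num.sqrt _ => t1 tM.
have t0 : 0 < t by lra.
rewrite ler_pdivrMr ?oppr_gt0// in tM.
have -> : g + b / 2 * t^-1 + p * t^-1 ^+ 2 = (g * t + b / 2 + p * t^-1) / t.
  by field; rewrite gt_eqF.
rewrite pmulr_lle0 ?invr_gt0//.
have : p * t^-1 <= `|p|.
  apply: (le_trans (ler_norm _)); rewrite normrM ler_piMr//.
  by rewrite gtr0_norm ?invr_gt0// invf_le1.
have := ler_norm b; lra.
Unshelve. all: by end_near. Qed.

(** Isolates the leading coefficient [g (g - 1)]; everything else carries a factor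
    [1 / sqrt (ln x)]. *)
Lemma log_exp_power2E p b g x : 1 < x ->
  log_exp_power2 p b g x = log_exp_power p b (g - 2) x *
    (g * (g - 1) + (Num.sqrt (ln x))^-1 *
      (b * (g - 2^-1) + (p * (2 * g - 1) + b ^+ 2 / 4) * (Num.sqrt (ln x))^-1
       + b * (p - 4^-1) * (Num.sqrt (ln x))^-1 ^+ 2
       + p * (p - 1) * (Num.sqrt (ln x))^-1 ^+ 3)).
Proof.
move=> x1; rewrite /log_exp_power2 !log_exp_power1E//.
rewrite (log_exp_power_subn_half _ _ _ _ 2)// (log_exp_power_subn_half _ _ _ _ 1)//.
have -> : g - 1 - 1 = g - 2 by ring.
by field; rewrite gt_eqF// sqrtr_gt0 ln_gt0.
Qed.

End log_exp_power.

(** * Factors [1 + O((ln x)^(-1/4))] and their stability *)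

Section near_one.
Context {R : realType}.
Implicit Types (f : R -> R) (x u a b p g : R).

(** The Landau factor with its constant exposed, since the same [M] has to serve at every point of a
    ray. *)
Definition near_one f : Prop := exists2 M : R, 0 <= M &
  \forall x \near +oo, `|f x - 1| <= M * ln x `^ (- (1 / 4)).

Lemma ln_powRN_le1 x : 1 <= ln x -> ln x `^ (- (1 / 4)) <= 1.
Proof.
move=> u1; rewrite -[leRHS](powRr0 (ln x)); apply: ler_powR => //; lra.
Qed.

Lemma near_ln_powRN_le (e : R) : 0 < e ->
  \forall x \near +oo, ln x `^ (- (1 / 4)) <= e.
Proof.
move=> e0; near=> x.
have u0 : e^-1 ^+ 4 <= ln x by near: x; exact: near_ln_ge.
have e4 : 0 < e^-1 ^+ 4 by rewrite exprn_gt0// invr_gt0.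
have lu : 0 < ln x by exact: lt_le_trans u0.
rewrite powRN -[e]invrK lef_pV2 ?posrE ?powR_gt0 ?invr_gt0//.
have -> : e^-1 = (e^-1 ^+ 4) `^ (1 / 4).
  rewrite -powR_mulrn ?invr_ge0 ?(ltW e0)// -powRrM mulrC divfK//.
  by rewrite powRr1// invr_ge0 ltW.
by apply: ge0_ler_powR; rewrite ?nnegrE ?(ltW e4) ?(ltW lu)//; lra.
Unshelve. all: by end_near. Qed.

(** Differentiation and rescaling cost errors of order [(ln x)^(-1/2)]; this absorbs them into the
    coarser rate. *)
Lemma inv_sqrt_le_powRN u : 1 <= u -> (Num.sqrt u)^-1 <= u `^ (- (1 / 4)).
Proof.
move=> u1; have u0 : 0 < u by lra.
rewrite -powR12_sqrt ?(ltW u0)// -powRN; apply: ler_powR => //; lra.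
Qed.

Lemma ln_powRN_nonincreasing K x : 1 < K -> K <= x ->
  ln x `^ (- (1 / 4)) <= ln K `^ (- (1 / 4)).
Proof.
move=> K1 Kx; have K0 : 0 < K by lra.
have x0 : 0 < x by exact: lt_le_trans Kx.
have lK : 0 < ln K by rewrite ln_gt0.
have lKx : ln K <= ln x by rewrite ler_ln.
have lx : 0 < ln x by exact: lt_le_trans lKx.
rewrite !powRN lef_pV2 ?posrE ?powR_gt0//.
by apply: ge0_ler_powR; rewrite ?nnegrE ?(ltW lK) ?(ltW lx)//; lra.
Qed.

Lemma near_oneM f (g : R -> R) : near_one f -> near_one g -> near_one (fun x => f x * g x).
Proof.
move=> [M M0 Mf] [N N0 Ng]; exists (M + N + M * N).
  by rewrite !addr_ge0// mulr_ge0.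
near=> x.
have h1 : ln x `^ (- (1 / 4)) <= 1 by near: x; exact: near_ln_powRN_le.
have hf : `|f x - 1| <= M * ln x `^ (- (1 / 4)) by near: x.
have hg : `|g x - 1| <= N * ln x `^ (- (1 / 4)) by near: x.
have h0 := powR_ge0 (ln x) (- (1 / 4)).
(* The last term is quadratic in the rate, hence linear once the rate is at most [1]; this yields
   the constant [M + N + M * N]. *)
have -> : f x * g x - 1 = (f x - 1) + (g x - 1) + (f x - 1) * (g x - 1) by ring.
apply: (le_trans (ler_normD _ _)); rewrite [leRHS]mulrDl [in leRHS]mulrDl.
apply: lerD; first by apply: (le_trans (ler_normD _ _)); exact: lerD.
rewrite normrM (le_trans (ler_pM _ _ hf hg))//.
set h := _ `^ _ in h1 h0 *.
have -> : M * h * (N * h) = M * N * h * h by ring.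
by rewrite ler_piMr// !mulr_ge0.
Unshelve. all: by end_near. Qed.

Lemma near_one_ge_half f : near_one f -> \forall x \near +oo, 2^-1 <= f x.
Proof.
move=> [M M0 Mf]; near=> x.
have hf : `|f x - 1| <= M * ln x `^ (- (1 / 4)) by near: x.
(* Forces [M h <= 1 / 2]; the [+ 1] covers [M = 0]. *)
have h1 : ln x `^ (- (1 / 4)) <= (2 * (M + 1))^-1.
  by near: x; apply: near_ln_powRN_le; rewrite invr_gt0; lra.
have h0 := powR_ge0 (ln x) (- (1 / 4)).
set h := _ `^ _ in hf h1 h0 *.
rewrite -(ler_pM2l (_ : 0 < 2 * (M + 1))) ?mulfV in h1; [|lra..].
move: hf; rewrite ler_norml; nra.
Unshelve. all: by end_near. Qed.

Lemma near_oneV f : near_one f -> near_one (fun x => (f x)^-1).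
Proof.
move=> f1; have f_ge := near_one_ge_half _ f1; move: f1 => [M M0 Mf].
exists (2 * M); first lra.
near=> x.
have hf : `|f x - 1| <= M * ln x `^ (- (1 / 4)) by near: x.
have f2 : 2^-1 <= f x by near: x.
have f0 : 0 < f x by lra.
(* Since [f x >= 1 / 2], dividing by [f x] at most doubles the error. *)
have -> : (f x)^-1 - 1 = - (f x - 1) * (f x)^-1 by field; rewrite gt_eqF.
rewrite normrM normrN [`|_^-1|]gtr0_norm ?invr_gt0//.
rewrite ler_pdivrMr//; apply: (le_trans hf).
have : 0 <= M * ln x `^ (- (1 / 4)) by rewrite mulr_ge0 ?powR_ge0.
nra.
Unshelve. all: by end_near. Qed.

Lemma near_one_expR f (M : R) : 0 <= M ->
  (\forall x \near +oo, `|f x| <= M * ln x `^ (- (1 / 4))) ->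
  near_one (fun x => expR (f x)).
Proof.
move=> M0 Mf; exists (2 * M); first lra.
near=> x.
have hf : `|f x| <= M * ln x `^ (- (1 / 4)) by near: x.
have h1 : ln x `^ (- (1 / 4)) <= (2 * (M + 1))^-1.
  by near: x; apply: near_ln_powRN_le; rewrite invr_gt0; lra.
have h0 := powR_ge0 (ln x) (- (1 / 4)).
set h := _ `^ _ in hf h1 h0 *.
have Mh : M * h <= 2^-1.
  rewrite -(ler_pM2l (_ : 0 < 2 * (M + 1))) ?mulfV in h1; [|lra..].
  nra.
have e1 := expR_ge1Dx (f x).
have e2 := expR_ge1Dx (- f x).
have e0 := expR_gt0 (f x).
have e12 : expR (f x) * expR (- f x) = 1 by rewrite -expRD subrr expR0.
move: hf; rewrite ler_norml => /andP[hf1 hf2].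
set z := f x in e1 e2 e0 e12 hf1 hf2 *.
(* From [1 - z <= e^(-z)]. As [z <= 1 / 2], it gives [e^z <= 2], and then [e^z - 1 <= z e^z] is the
   upper bound; the lower one is [1 + z <= e^z]. *)
have e3 : expR z * (1 - z) <= 1 by rewrite -[leRHS]e12 ler_pM2l.
have E2 : expR z <= 2 by nra.
rewrite ler_norml; apply/andP; split; first lra.
nra.
Unshelve. all: by end_near. Qed.

(** The factor [1 / 2] would already do; [16 = 2^4] is chosen so that the power [- 1 / 4] turns it
    into exactly [2]. *)
Lemma ln_div_ge a : 0 < a -> \forall x \near +oo, ln x / 16 <= ln (x / a).
Proof.
move=> a0; near=> x.
have x0 : 0 < x by near: x; apply: nbhs_pinfty_gt; rewrite num_real.
have h : 2 * `|ln a| <= ln x by near: x; exact: near_ln_ge.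
rewrite ln_div ?posrE//; have := ler_norm (ln a); have := normr_ge0 (ln a); lra.
Unshelve. all: by end_near. Qed.

Lemma near_one_div f a : 0 < a -> near_one f -> near_one (fun x => f (x / a)).
Proof.
move=> a0 [M M0 [N [Nr Mf]]]; exists (2 * M); first lra.
near=> x.
have xN : N < x / a.
  rewrite ltr_pdivlMr//; near: x; apply: nbhs_pinfty_gt; exact: num_real.
have u0 : 0 < ln x by near: x; have := near_ln_ge (1 : R); apply: filterS => y; lra.
have u1 : ln x / 16 <= ln (x / a) by near: x; exact: ln_div_ge.
apply: (le_trans (Mf _ xN)); rewrite [2 * _]mulrC -mulrA ler_wpM2l//.
have -> : 2 * ln x `^ (- (1 / 4)) = (ln x / 16) `^ (- (1 / 4)).
  rewrite powRM ?(ltW u0)//; rewrite mulrC; congr (_ * _).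
  have -> : (16 : R) = 2 `^ 4 by rewrite (powR_mulrn 4)//; ring.
  by rewrite -powRN -powRrM mulrNN mulrC divfK// powRr1.
rewrite !powRN lef_pV2 ?posrE ?powR_gt0//; [|lra..].
by apply: ge0_ler_powR; rewrite ?nnegrE//; lra.
Unshelve. all: by end_near. Qed.

(** Rescaling the argument multiplies the power by exactly [a^(-g)], while [ln (ln x)] and
    [sqrt (ln x)] move only by [O((ln x)^(-1/2))]. The witness is the exponential of these two
    shifts, so the identity is exact and only the size of [rho] needs estimating. *)
Lemma log_exp_power_div p b g a : 0 < a -> exists2 rho, near_one rho &
  \forall x \near +oo, log_exp_power p b g (x / a) =
    a `^ (- g) * log_exp_power p b g x * rho x.
Proof.
move=> a0.
exists (fun x => expR (p * (ln (ln (x / a)) - ln (ln x)) +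
                 b * (Num.sqrt (ln (x / a)) - Num.sqrt (ln x)))).
  apply: (@near_one_expR _ (`|p| * (16 * `|ln a|) + `|b| * (4 * `|ln a|))).
    by rewrite !addr_ge0// !mulr_ge0.
  near=> x.
  have x0 : 0 < x by near: x; apply: nbhs_pinfty_gt; rewrite num_real.
  have u1 : 16 <= ln x by near: x; exact: near_ln_ge.
  have v16 : ln x / 16 <= ln (x / a) by near: x; exact: ln_div_ge.
  have hs : (Num.sqrt (ln x))^-1 <= ln x `^ (- (1 / 4)).
    by apply: inv_sqrt_le_powRN; lra.
  have vE : ln (x / a) = ln x - ln a by rewrite ln_div.
  set h := _ `^ _ in hs *.
  move: vE v16 u1 hs; set v := ln (x / a); set u := ln x => vE v16 u1 hs.
  set t := Num.sqrt u in hs *; set s := Num.sqrt v.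
  have tE : t ^+ 2 = u by rewrite sqr_sqrtr//; lra.
  have sE : s ^+ 2 = v by rewrite sqr_sqrtr//; lra.
  have t0 : 0 < t by rewrite sqrtr_gt0; lra.
  have s0 : 0 < s by rewrite sqrtr_gt0; lra.
  have t1 : 1 <= t by rewrite -(sqrtr1 R) ler_wsqrtr//; lra.
  have h1 : `|s - t| <= `|ln a| * t^-1.
    (* Difference of squares: [s^2 - t^2 = - ln a]. *)
    have -> : s - t = - ln a / (s + t).
      have -> : - ln a = s ^+ 2 - t ^+ 2 by rewrite tE sE vE; ring.
      by field; rewrite gt_eqF// addr_gt0.
    rewrite normrM normrN ler_wpM2l// gtr0_norm ?invr_gt0 ?addr_gt0//.
    by rewrite lef_pV2 ?posrE ?addr_gt0// lerDr ltW.
  (* Concavity bound [ln (1 + w) <= w]; using it with both orders of [u] and [v] bounds the absolute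
     value. *)
  have ln_diff (y z : R) : 0 < y -> 0 < z -> ln y - ln z <= (y - z) / z.
    move=> y0 z0; rewrite -ln_div ?posrE//.
    have -> : y / z = 1 + (y - z) / z by field; rewrite gt_eqF.
    apply: le_ln1Dx; rewrite -subr_gt0 opprK.
    have -> : (y - z) / z + 1 = y / z by field; rewrite gt_eqF.
    exact: divr_gt0.
  have h2 : `|ln v - ln u| <= 16 * `|ln a| * t^-1.
    have u0 : 0 < u by lra.
    have v0 : 0 < v by lra.
    have la := ler_norm (ln a).
    have lna : - ln a <= `|ln a| by rewrite -normrN ler_norm.
    have tu : u^-1 <= t^-1 by rewrite lef_pV2 ?posrE// -tE; nra.
    have tv : v^-1 <= 16 * t^-1.
      apply: (@le_trans _ _ (16 * u^-1)); last lra.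
      rewrite -[16]invrK -invfM lef_pV2 ?posrE ?mulr_gt0//; lra.
    have u'0 : 0 < u^-1 by rewrite invr_gt0.
    have v'0 : 0 < v^-1 by rewrite invr_gt0.
    have ta : 0 <= `|ln a| * t^-1 by rewrite mulr_ge0// invr_ge0 ltW.
    rewrite ler_norml; apply/andP; split.
      rewrite lerNl opprB; apply: (le_trans (ln_diff _ _ u0 v0)).
      have -> : u - v = ln a by rewrite vE; ring.
      apply: (@le_trans _ _ (`|ln a| * v^-1)); first by rewrite ler_pM2r.
      rewrite [16 * _]mulrC -mulrA ler_wpM2l//.
    apply: (le_trans (ln_diff _ _ v0 u0)).
    have -> : v - u = - ln a by rewrite vE; ring.
    apply: (@le_trans _ _ (`|ln a| * u^-1)); first by rewrite ler_pM2r.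
    apply: (@le_trans _ _ (`|ln a| * t^-1)); first by rewrite ler_wpM2l.
    lra.
  have ha : `|ln a| * t^-1 <= `|ln a| * h by rewrite ler_wpM2l.
  have ha0 : 0 <= `|ln a| * t^-1 by rewrite mulr_ge0// invr_ge0 ltW.
  apply: (le_trans (ler_normD _ _)); rewrite !normrM mulrDl -!mulrA.
  by apply: lerD; rewrite ler_wpM2l//; lra.
near=> x.
have x1 : 1 < x by near: x; apply: nbhs_pinfty_gt; rewrite num_real.
have x0 : 0 < x by lra.
have u1 : 16 <= ln x by near: x; exact: near_ln_ge.
have v16 : ln x / 16 <= ln (x / a) by near: x; exact: ln_div_ge.
rewrite /log_exp_power.
have -> : (x / a) `^ g = a `^ (- g) * x `^ g.
  rewrite powRM ?invr_ge0 ?ltW// mulrC; congr (_ * _).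
  by rewrite -powR_inv1 ?ltW// -powRrM mulN1r.
rewrite /powR !gt_eqF//; [|lra..].
rewrite -!expRD; congr expR; ring.
Unshelve. all: by end_near. Qed.

(** The expansion is divided by its leading coefficient; as [s x <= 1] eventually, the cubic [q] is
    bounded by the sum of its absolute coefficients. *)
Lemma log_exp_power2_near_one p b g : 0 < g * (g - 1) -> exists2 k, near_one k &
  \forall x \near +oo, log_exp_power2 p b g x =
    g * (g - 1) * log_exp_power p b (g - 2) x * k x.
Proof.
move=> G0.
pose c1 := b * (g - 2^-1); pose c2 := p * (2 * g - 1) + b ^+ 2 / 4.
pose c3 := b * (p - 4^-1); pose c4 := p * (p - 1).
pose s x := (Num.sqrt (ln x))^-1.
pose q x := c1 + c2 * s x + c3 * s x ^+ 2 + c4 * s x ^+ 3.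
exists (fun x => 1 + s x * q x / (g * (g - 1))).
  exists ((`|c1| + `|c2| + `|c3| + `|c4|) / (g * (g - 1))).
    by rewrite divr_ge0// ?(ltW G0)// !addr_ge0.
  near=> x.
  have u1 : 1 <= ln x by near: x; exact: near_ln_ge.
  have hs : s x <= ln x `^ (- (1 / 4)) by exact: inv_sqrt_le_powRN.
  have s0 : 0 <= s x by rewrite invr_ge0 sqrtr_ge0.
  have s1 : s x <= 1 by apply: (le_trans hs); exact: ln_powRN_le1.
  rewrite addrC addKr normrM [`|_^-1|]gtr0_norm ?invr_gt0//.
  rewrite [leRHS]mulrAC ler_pM2r ?invr_gt0// normrM mulrC (ger0_norm s0) ler_pM//.
  have cs (c : R) n : `|c * s x ^+ n| <= `|c|.
    by rewrite normrM ler_piMr// normrX ger0_norm// exprn_ile1.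
  rewrite /q; apply: (le_trans (ler_normD _ _)); apply: lerD; last exact: cs.
  apply: (le_trans (ler_normD _ _)); apply: lerD; last exact: cs.
  by apply: (le_trans (ler_normD _ _)); apply: lerD; last exact: (cs c2 1%N).
near=> x.
have x1 : 1 < x by near: x; apply: nbhs_pinfty_gt; rewrite num_real.
rewrite log_exp_power2E// -/(s x) -/c1 -/c2 -/c3 -/c4 -/(q x).
field.
by apply/andP; split; apply: contraTneq G0 => E; rewrite E ?(mul0r, mulr0) ltxx.
Unshelve. all: by end_near. Qed.

End near_one.

(** * From the density asymptotics to the call price *)

Lemma asymptoticP (R : realType) (f : R -> \bar R) (g : R -> R) :
  asymptotic f g (fun x => ln x `^ (- (1 / 4))) <->
  exists2 k, near_one k & \forall x \near +oo, f x = (g x * k x)%:E.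
Proof.
split=> [[e /eqO_exP[M M0 Me] fe]|[k [M M0 Mk] fk]].
  exists (fun x => 1 + e x) => //; exists M; first exact: ltW.
  move: Me; apply: filterS => x.
  by rewrite addrC addKr [`|_ `^ _|]ger0_norm ?powR_ge0.
exists (fun x => k x - 1 : R^o).
  (* The Landau constant must be positive, whereas [M] may be [0]. *)
  apply/eqO_exP; exists (M + 1); first exact: ltr_wpDl.
  move: Mk; apply: filterS => x /le_trans; apply.
  by rewrite [`|_ `^ _|]ger0_norm ?powR_ge0// ler_wpM2r ?powR_ge0// lerDl.
by move: fk; apply: filterS => x ->; rewrite addrC subrK.
Qed.

(** The given asymptotics are read at [x / a]. Undoing the scaling produces [a^c], and replacing the
    leading term by the second derivative produces the denominator [(1 - c)(2 - c)], which is
    [g (g - 1)] at [g = 2 - c]. *)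
Lemma density_log_exp_power2 (R : realType) (D : R -> R) (a B p b c : R) :
  0 < a -> 2 < c ->
  asymptotic (fun x => (D (a * x))%:E)
    (fun x => B * ln x `^ p * expR (b * Num.sqrt (ln x)) * x `^ (- c))
    (fun x => ln x `^ (- (1 / 4))) ->
  exists2 k, near_one k & \forall x \near +oo,
    D x = B * a `^ c / ((1 - c) * (2 - c)) * log_exp_power2 p b (2 - c) x * k x.
Proof.
move=> a0 c2 /asymptoticP[k1 ok1 Dk1].
have [k2 ok2 E2] := log_exp_power_div p b (- c) _ a0.
have cc : 0 < (2 - c) * (2 - c - 1) by nra.
have [k3 ok3 E3] := log_exp_power2_near_one p b _ cc.
exists (fun x => k1 (x / a) * k2 x * (k3 x)^-1).
  exact: near_oneM _ _ (near_oneM _ _ (near_one_div _ _ a0 ok1) ok2) (near_oneV _ ok3).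
have [N [Nr DN]] := Dk1.
near=> x.
have xN : N < x / a.
  by rewrite ltr_pdivlMr//; near: x; apply: nbhs_pinfty_gt; exact: num_real.
have := DN _ xN; rewrite [a * _]mulrC divfK ?gt_eqF// => -[->].
have e2 : log_exp_power p b (- c) (x / a) =
  a `^ (- - c) * log_exp_power p b (- c) x * k2 x by near: x.
have e3 : log_exp_power2 p b (2 - c) x = (2 - c) * (2 - c - 1) *
  log_exp_power p b (2 - c - 2) x * k3 x by near: x.
have k30 : 2^-1 <= k3 x by near: x; exact: near_one_ge_half.
rewrite e3.
have -> : B * ln (x / a) `^ p * expR (b * Num.sqrt (ln (x / a))) * (x / a) `^ (- c)
  = B * log_exp_power p b (- c) (x / a) by rewrite /log_exp_power; ring.
rewrite e2 opprK; have -> : 2 - c - 2 = - c by ring.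
field.
by rewrite !neq_lt; apply/and3P; split; apply/orP; lra.
Unshelve. all: by end_near. Qed.

(** Serves both models, which differ here only in [p] and the constants. *)
Lemma call_price_asymptotic (R : realType) (d : measure_display)
    (Omega : measurableType d) (P : probability Omega R) (X : R -> Omega -> R)
    (D : R -> R) (r T a B p b c : R) :
  measurable_fun setT (X T) -> is_density P D (X T) ->
  0 < a -> 0 < B -> 2 < c ->
  asymptotic (fun x => (D (a * x))%:E)
    (fun x => B * ln x `^ p * expR (b * Num.sqrt (ln x)) * x `^ (- c))
    (fun x => ln x `^ (- (1 / 4))) ->
  asymptotic (call_price P r T X)
    (fun K => expR (- r * T) * (B * a `^ c / ((1 - c) * (2 - c)))
              * ln K `^ p * expR (b * Num.sqrt (ln K)) * K `^ (2 - c))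
    (fun K => ln K `^ (- (1 / 4))).
Proof.
move=> mX hD a0 B0 c2 /(density_log_exp_power2 _ _ _ _ _ _ _ a0 c2)[k [M M0 Mk] Dk].
have cc : 0 < (2 - c) * (2 - c - 1) by nra.
have [k3 ok3 E3] := log_exp_power2_near_one p b _ cc.
have C0 : 0 < B * a `^ c / ((1 - c) * (2 - c)).
  by apply: divr_gt0; [rewrite mulr_gt0// powR_gt0|nra].
move: Dk; set C := B * a `^ c / _ in C0 * => Dk.
set G := log_exp_power p b (2 - c); set G2 := log_exp_power2 p b (2 - c).
set h := fun x : R => ln x `^ (- (1 / 4)).
have G2_near : \forall x \near +oo, 0 <= G2 x.
  near=> x.
  have x1 : 1 < x by near: x; apply: nbhs_pinfty_gt; rewrite num_real.
  have k30 : 2^-1 <= k3 x by near: x; exact: near_one_ge_half.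
  have e3 : G2 x = (2 - c) * (2 - c - 1) * log_exp_power p b (2 - c - 2) x * k3 x.
    by near: x.
  rewrite e3; apply: mulr_ge0; last lra.
  by apply: mulr_ge0; apply: ltW => //; exact: log_exp_power_gt0.
have G1_near : \forall x \near +oo, log_exp_power1 p b (2 - c) x <= 0.
  by apply: near_log_exp_power1_le0; lra.
have sandwich : \forall K \near +oo,
    ((C * (1 - M * h K) * G K)%:E <= 'E_P[(fun w => Num.max (X T w - K) 0)%R]
       <= (C * (1 + M * h K) * G K)%:E)%E.
  have near_all := near_pinfty_forall_ge _ (filterI Mk (filterI Dk (filterI G2_near G1_near))).
  near=> K.
  have K1 : 1 < K by near: K; apply: nbhs_pinfty_gt; rewrite num_real.
  have all_ge : forall x, K <= x ->
    ((`|k x - 1| <= M * ln x `^ (- (1 / 4))) /\ (D x = C * G2 x * k x /\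
     (0 <= G2 x /\ log_exp_power1 p b (2 - c) x <= 0))).
    near: K; exact: near_all.
  (* Keeps the lower factor [1 - M h K] nonnegative, as the sandwich requires. *)
  have hM : h K <= (M + 1)^-1 by near: K; apply: near_ln_powRN_le; rewrite invr_gt0; lra.
  have h0 : 0 <= h K by exact: powR_ge0.
  have Mh1 : M * h K <= 1.
    rewrite -(ler_pM2l (_ : 0 < M + 1)) ?mulfV in hM; [|lra..]; nra.
  have Mh0 : 0 <= M * h K by exact: mulr_ge0.
  (* The rate decreases, so its value at [K] controls the error on the whole ray. *)
  have kM x : K <= x -> 1 - M * h K <= k x <= 1 + M * h K.
    move=> Kx; have [kx _] := all_ge x Kx.
    have : M * ln x `^ (- (1 / 4)) <= M * h K.
      by rewrite ler_wpM2l// ln_powRN_nonincreasing.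
    by move/(le_trans kx); rewrite ler_norml => /andP[? ?]; apply/andP; split; lra.
  apply: (@expectation_call_sandwich _ _ _ P D (X T) mX hD G
    (log_exp_power1 p b (2 - c)) G2).
  - by rewrite mulr_ge0 ?(ltW C0)//; lra.
  - by rewrite mulr_ge0 ?(ltW C0)//; lra.
  - by move=> x Kx; apply: is_derive_log_exp_power; exact: lt_le_trans Kx.
  - by move=> x Kx; apply: is_derive_log_exp_power1; exact: lt_le_trans Kx.
  - by move=> x Kx; apply: continuous_log_exp_power2; exact: lt_le_trans Kx.
  - by move=> x /all_ge[_ [_ []]].
  - by move=> x /all_ge[_ [_ []]].
  - by apply: log_exp_power_cvg0; lra.
  - by apply: log_exp_power1_cvg0; lra.
  - move=> x Kx; have [_ [-> [g2 _]]] := all_ge x Kx; have /andP[kl kr] := kM x Kx.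
    by rewrite mulrAC ler_wpM2l// mulr_ge0// ltW.
  - move=> x Kx; have [_ [-> [g2 _]]] := all_ge x Kx; have /andP[kl kr] := kM x Kx.
    by rewrite [leRHS]mulrAC ler_wpM2l// mulr_ge0// ltW.
apply/asymptoticP.
(* The correction factor is the ratio of the expectation to [C * G K]. [fine] would send an infinite
   value to [0], but the finite bounds on both sides exclude this for large [K]. *)
exists (fun K => fine 'E_P[(fun w => Num.max (X T w - K) 0)%R] / (C * G K)).
  exists M => //; near=> K.
  have K1 : 1 < K by near: K; apply: nbhs_pinfty_gt; rewrite num_real.
  have G0 : 0 < G K by exact: log_exp_power_gt0.
  have /andP[lo hi] : ((C * (1 - M * h K) * G K)%:E <=
    'E_P[(fun w => Num.max (X T w - K) 0)%R] <= (C * (1 + M * h K) * G K)%:E)%E.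
    by near: K.
  move: lo hi; case: expectation => // E; rewrite !lee_fin /= => lo hi.
  rewrite -/(h K).
  have CG0 : 0 < C * G K by exact: mulr_gt0.
  rewrite ler_norml lerBrDr lerBlDr ler_pdivlMr// ler_pdivrMr//.
  apply/andP; split; [apply: le_trans lo|apply: (le_trans hi)].
    by rewrite [leLHS](_ : _ = C * (1 - M * h K) * G K)//; ring.
  by rewrite [leRHS](_ : _ = C * (1 + M * h K) * G K)//; ring.
near=> K.
have K1 : 1 < K by near: K; apply: nbhs_pinfty_gt; rewrite num_real.
have G0 : 0 < G K by exact: log_exp_power_gt0.
have /andP[lo hi] : ((C * (1 - M * h K) * G K)%:E <=
  'E_P[(fun w => Num.max (X T w - K) 0)%R] <= (C * (1 + M * h K) * G K)%:E)%E.
  by near: K.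
rewrite /call_price; move: lo hi; case: expectation => // E _ _ /=.
rewrite -EFinM; congr EFin.
have -> : expR (- r * T) * C * ln K `^ p * expR (b * Num.sqrt (ln K)) *
  K `^ (2 - c) = expR (- r * T) * (C * G K).
  by rewrite /G /log_exp_power; ring.
by field; rewrite !gt_eqF.
Unshelve. all: by end_near. Qed.

Theorem theorem7p3 (R : realType) (d : measure_display)
    (Omega : measurableType d) (P : probability Omega R)
    (F : R -> set (set Omega)) (W Z X Y : R -> Omega -> R)
    (x0 y0 r q m T : R) (D : R -> R)
    (hx0 : 0 < x0) (hr : 0 <= r) (hq : 0 <= q) (hm : 0 <= m) (hT : 0 < T)
    (hD : is_density P D (X T)) :
  (forall sigma B1 B2 B3 : R,
     0 < sigma -> stein_stein_model P r q m sigma x0 y0 F W Z X Y ->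
     0 < B1 -> 0 < B2 -> 2 < B3 ->
     asymptotic (fun x => (D (x0 * expR (r * T) * x))%:E)
       (fun x => B1 * ln x `^ (- (1 / 2)) * expR (B2 * Num.sqrt (ln x))
                 * x `^ (- B3))
       (fun x => ln x `^ (- (1 / 4))) ->
     let B0 := B1 * (x0 * expR (r * T)) `^ B3 in
     asymptotic (call_price P r T X)
       (fun K => expR (- r * T) * (B0 / ((1 - B3) * (2 - B3)))
                 * ln K `^ (- (1 / 2)) * expR (B2 * Num.sqrt (ln K))
                 * K `^ (2 - B3))
       (fun K => ln K `^ (- (1 / 4))))
  /\
  (forall c A1 A2 A3 : R,
     0 < c -> heston_model P r q m c x0 y0 F W Z X Y ->
     0 < A1 -> 0 < A2 -> 2 < A3 ->
     asymptotic (fun x => (D (x0 * expR (r * T) * x))%:E)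
       (fun x => A1 * ln x `^ (- (3 / 4) + q * m / c ^+ 2)
                 * expR (A2 * Num.sqrt (ln x)) * x `^ (- A3))
       (fun x => ln x `^ (- (1 / 4))) ->
     let A0 := A1 * (x0 * expR (r * T)) `^ A3 in
     asymptotic (call_price P r T X)
       (fun K => expR (- r * T) * (A0 / ((1 - A3) * (2 - A3)))
                 * ln K `^ (- (3 / 4) + q * m / c ^+ 2)
                 * expR (A2 * Num.sqrt (ln K)) * K `^ (2 - A3))
       (fun K => ln K `^ (- (1 / 4)))).
Proof.
(* Adaptedness at time [T] puts preimages in [F T], which consists of measurable sets. *)
have mX drift diffusion : filtration (R := R) F ->
    solves_sde P F W X x0 drift diffusion -> measurable_fun setT (X T).
  move=> [_ Fm _] [adX _ _] _ B mB; rewrite setTI.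
  by apply: (Fm T (ltW hT)); apply: adX => //; exact: ltW.
have a0 : 0 < x0 * expR (r * T) by rewrite mulr_gt0// expR_gt0.
split=> [sigma B1 B2 B3 _ [[filF _ _ _] sdeX _] B10 _ B32 asD|
         c A1 A2 A3 _ [[filF _ _ _] sdeX _ _] A10 _ A32 asD] /=.
- exact: (call_price_asymptotic _ _ _ _ _ _ _ _ _ _ _ _ _ (mX _ _ filF sdeX) hD a0 B10 B32 asD).
- exact: (call_price_asymptotic _ _ _ _ _ _ _ _ _ _ _ _ _ (mX _ _ filF sdeX) hD a0 A10 A32 asD).
Qed.
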